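(* Let $H$ be an infinite-dimensional complex Hilbert space, viewed as a metric structure in the many-sorted signature for complex Hilbert spaces described in the context. A bounded linear operator $T:H\to H$ is definable if and only if there exist $\lambda\in\mathbb{C}$ and a compact operator $K:H\to H$ such that $T=\lambda I+K$, where $I$ is the identity operator.
   Context: $H$ is treated as a many-sorted metric structure in continuous logic: for each $n\ge 1$ there is a sort for $B_n(H)=\{x\in H:\|x\|\le n\}$ with metric $d(x,y)=\|x-y\|$; there are function symbols for the inclusions $B_m(H)\to B_n(H)$ ($m\le n$), for $+,-:B_n(H)\times B_n(H)\to B_{2n}(H)$, for multiplication by each real $r$ as a map $B_n(H)\to B_{kn}(H)$ where $k\in\mathbb{N}$ satisfies $k-1\le|r|<k$, for multiplication by $i$ as a map $B_n(H)\to B_n(H)$, predicate symbols $\mathfrak{Re},\mathfrak{Im}:B_n(H)\times B_n(H)\to[-n^2,n^2]$ interpreted as the real and imaginary parts of the inner product, and a norm predicate $B_n(H)\to[0,n]$. For $A\subseteq H$, a function $f:H\to H$ is $A$-definable if (1) for each $n\ge 1$, $f(B_n(H))$ is bounded (let $m(n,f)$ be the least $m\in\mathbb{N}$ with $f(B_n(H))\subseteq B_m(H)$), and (2) for each $n\ge1$ and $m\ge m(n,f)$, the predicate $P_{n,m}(x,y)=d(f(x),y)$ on $B_n(H)\times B_m(H)$ is an $A$-definable predicate in the sense of continuous logic (a uniform limit of formulas with parameters from $A$). A function is definable if it is $A$-definable for some $A\subseteq H$. *)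

(* Defs.v *)
From HB Require Import structures.
From mathcomp Require Import all_boot all_order all_algebra.
From mathcomp Require Import all_classical all_reals all_analysis.
From mathcomp Require Import complex.

Set Implicit Arguments.
Unset Strict Implicit.
Unset Printing Implicit Defensive.

Import Order.TTheory GRing.Theory Num.Theory.
Import numFieldNormedType.Exports.

Local Open Scope classical_set_scope.
Local Open Scope ring_scope.

(* The library's norm on a normed module over R[i] takes its values in R[i];
   rnorm below is the same norm read as a real number. *)
Record hilbertSpace (R : realType) := HilbertSpace {
  hilbert_sort :> completeNormedModType R[i];
  inner : {dot hilbert_sort for (@Num.conj R[i])};
  inner_norm : forall x : hilbert_sort, `|x| ^+ 2 = inner x x
}.

Section Hilbert.
Context {R : realType} {H : hilbertSpace R}.
Implicit Types (x y : H) (T K : {linear H -> H}).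

Definition rnorm x : R := complex.Re `|x|.

Lemma rnormE x : (rnorm x)%:C%C = `|x|.
Proof. by rewrite /rnorm RRe_real // normr_real. Qed.

Lemma rnorm_ge0 x : 0 <= rnorm x.
Proof. by rewrite -ler0c rnormE. Qed.

Lemma rnormD x y : rnorm (x + y) <= rnorm x + rnorm y.
Proof. by rewrite -lecR rmorphD /= !rnormE ler_normD. Qed.

Lemma rnormN x : rnorm (- x) = rnorm x.
Proof. by rewrite /rnorm normrN. Qed.

Lemma rnormZr (r : R) x : rnorm (r%:C%C *: x) = `|r| * rnorm x.
Proof.
by apply: complexI; rewrite rmorphM /= !rnormE normrZ normc_def /= expr0n addr0 sqrtr_sqr.
Qed.

Lemma rnormZi x : rnorm ('i%C *: x) = rnorm x.
Proof.
by apply: complexI; rewrite !rnormE normrZ normc_def /= expr0n expr1n add0r sqrtr1 mul1r.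
Qed.

Definition bounded_operator T := exists M : R, forall x, rnorm (T x) <= M * rnorm x.

Definition compact_operator K := precompact (K @` [set x | rnorm x <= 1]).

End Hilbert.

Definition infinite_dimensional (R : realType) (H : hilbertSpace R) :=
  ~ exists (n : nat) (e : 'I_n -> H),
      forall x : H, exists c : 'I_n -> R[i], x = \sum_(i < n) c i *: e i.

(* Sorts are the integers n >= 1; sort n is interpreted by the closed ball of
   radius n. *)
Record ballSort := BallSort { radius :> nat; radius_gt0 : (0 < radius)%N }.

Lemma mul_sort_gt0 (k n : ballSort) : (0 < k * n)%N.
Proof. by rewrite muln_gt0 !radius_gt0. Qed.

Definition mul_sort (k n : ballSort) : ballSort := BallSort (mul_sort_gt0 k n).

Definition two_sort : ballSort := @BallSort 2 isT.

Section BallStructure.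
Context {R : realType} (H : hilbertSpace R).

Definition Bset (n : nat) : set H := [set x | rnorm x <= n%:R].

Definition Bsort (n : ballSort) := {x : H | rnorm x <= n%:R}.

Section Operations.
Context {n : ballSort}.
Implicit Types x y : Bsort n.

Fact Bincl_subproof m (nm : (n <= m)%N) x : rnorm (sval x) <= m%:R.
Proof. by rewrite (le_trans (svalP x)) // ler_nat. Qed.

Definition Bincl (m : ballSort) (nm : (n <= m)%N) x : Bsort m :=
  exist _ (sval x) (Bincl_subproof nm x).

Fact Badd_subproof x y : rnorm (sval x + sval y) <= (mul_sort two_sort n)%:R.
Proof.
by rewrite (le_trans (rnormD _ _))//= mul2n -addnn natrD lerD ?(svalP x) ?(svalP y).
Qed.

Definition Badd x y : Bsort (mul_sort two_sort n) :=
  exist _ (sval x + sval y) (Badd_subproof x y).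

Fact Bsub_subproof x y : rnorm (sval x - sval y) <= (mul_sort two_sort n)%:R.
Proof.
by rewrite (le_trans (rnormD _ _))//= rnormN mul2n -addnn natrD lerD ?(svalP x) ?(svalP y).
Qed.

Definition Bsub x y : Bsort (mul_sort two_sort n) :=
  exist _ (sval x - sval y) (Bsub_subproof x y).

Fact Bscale_subproof (r : R) (k : ballSort) (rk : k%:R - 1 <= `|r| < k%:R) x :
  rnorm (r%:C%C *: sval x) <= (mul_sort k n)%:R.
Proof.
case/andP: rk => _ /ltW rk.
by rewrite rnormZr /= natrM ler_pM ?rnorm_ge0 ?(svalP x).
Qed.

Definition Bscale (r : R) (k : ballSort) (rk : k%:R - 1 <= `|r| < k%:R) x :
  Bsort (mul_sort k n) := exist _ (r%:C%C *: sval x) (Bscale_subproof rk x).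

Fact Bmuli_subproof x : rnorm ('i%C *: sval x) <= n%:R.
Proof. by rewrite rnormZi (svalP x). Qed.

Definition Bmuli x : Bsort n := exist _ ('i%C *: sval x) (Bmuli_subproof x).

End Operations.

End BallStructure.

Arguments Bset {R} H n _.

(* Well-sorted de Bruijn variables: [var G n] is the type of the variables of
   sort [n] in the context [G]. *)
Inductive var : seq ballSort -> ballSort -> Type :=
| Var0 n G : var (n :: G) n
| VarS n k G : var G n -> var (k :: G) n.

Section Logic.
Context {R : realType} {H : hilbertSpace R}.
Variable A : set H.

Inductive term (G : seq ballSort) : ballSort -> Type :=
| TVar n : var G n -> term G n
| TPar n (a : Bsort H n) : A (sval a) -> term G n
| TIncl (m n : ballSort) : (m <= n)%N -> term G m -> term G n
| TAdd n : term G n -> term G n -> term G (mul_sort two_sort n)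
| TSub n : term G n -> term G n -> term G (mul_sort two_sort n)
| TScale n (r : R) (k : ballSort) :
    k%:R - 1 <= `|r| < k%:R -> term G n -> term G (mul_sort k n)
| TMuli n : term G n -> term G n.

(* Every formula takes its values in a bounded set of reals, so that by Tietze's
   theorem the continuous connectives may be taken to be defined on the whole
   of R^k, and FSup, FInf are interpreted by genuine suprema and infima. *)
Inductive formula (G : seq ballSort) : Type :=
| FDist n : term G n -> term G n -> formula G
| FRe n : term G n -> term G n -> formula G
| FIm n : term G n -> term G n -> formula G
| FNorm n : term G n -> formula G
| FConn (k : nat) (u : 'rV[R]_k -> R) :
    continuous u -> ('I_k -> formula G) -> formula G
| FSup (n : ballSort) : formula (n :: G) -> formula G
| FInf (n : ballSort) : formula (n :: G) -> formula G.

Fixpoint env (G : seq ballSort) : Type :=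
  if G is n :: G' then (Bsort H n * env G')%type else unit.

Fixpoint eval_var G n (i : var G n) : env G -> Bsort H n :=
  match i with
  | Var0 _ _ => fun v => v.1
  | VarS _ _ _ j => fun v => eval_var j v.2
  end.

Fixpoint eval_term G n (v : env G) (t : term G n) : Bsort H n :=
  match t with
  | TVar _ i => eval_var i v
  | TPar _ a _ => a
  | TIncl _ _ mn t => Bincl mn (eval_term v t)
  | TAdd _ t1 t2 => Badd (eval_term v t1) (eval_term v t2)
  | TSub _ t1 t2 => Bsub (eval_term v t1) (eval_term v t2)
  | TScale _ _ _ rk t => Bscale rk (eval_term v t)
  | TMuli _ t => Bmuli (eval_term v t)
  end.

Fixpoint eval G (phi : formula G) : env G -> R :=
  match phi with
  | FDist _ t1 t2 => fun v =>
      rnorm (sval (eval_term v t1) - sval (eval_term v t2))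
  | FRe _ t1 t2 => fun v =>
      complex.Re (inner H (sval (eval_term v t1)) (sval (eval_term v t2)))
  | FIm _ t1 t2 => fun v =>
      complex.Im (inner H (sval (eval_term v t1)) (sval (eval_term v t2)))
  | FNorm _ t => fun v => rnorm (sval (eval_term v t))
  | FConn _ u _ args => fun v => u (\row_i eval (args i) v)
  | FSup n psi => fun v => sup (range (fun x : Bsort H n => eval psi (x, v)))
  | FInf n psi => fun v => inf (range (fun x : Bsort H n => eval psi (x, v)))
  end.

Definition definable_predicate (n m : ballSort)
    (P : Bsort H n -> Bsort H m -> R) : Prop :=
  exists phi : nat -> formula [:: n; m],
    forall e : R, 0 < e -> exists N : nat, forall j : nat, (N <= j)%N ->
      forall x y, `|eval (phi j) (x, (y, tt)) - P x y| <= e.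

(* [least_radius f n m] : m is the natural number m(n, f). *)
Definition least_radius (f : H -> H) (n m : nat) : Prop :=
  f @` Bset H n `<=` Bset H m /\
  forall m' : nat, f @` Bset H n `<=` Bset H m' -> (m <= m')%N.

Definition definable_over (f : H -> H) : Prop :=
  (forall n : ballSort, exists m : nat, f @` Bset H n `<=` Bset H m) /\
  (forall (n m : ballSort) (m0 : nat), least_radius f n m0 -> (m0 <= m)%N ->
    @definable_predicate n m (fun x y => rnorm (f (sval x) - sval y))).

End Logic.

Definition definable (R : realType) (H : hilbertSpace R) (f : H -> H) : Prop :=
  exists A : set H, definable_over A f.

(* Main.v *)
From HB Require Import structures.
Require Import Defs.
From mathcomp Require Import all_boot all_order all_algebra.
From mathcomp Require Import all_classical all_reals all_analysis.
From mathcomp Require Import complex ring lra zify.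

(* Formulas are invariant under every unitary that fixes their parameters.
   Applying this to the formulas that approximate |T x - y| and to the
   reflection along a unit vector w orthogonal to the finitely many parameters
   of such a formula, one finds that T almost commutes with the reflection, so
   that w is an approximate eigenvector of T.  As w ranges over the unit vectors
   of a subspace of finite codimension, the approximate eigenvalues must be
   close to each other; hence T is, up to a small error on such a subspace, a
   scalar.  The scalars obtained for smaller and smaller errors converge to some
   lambda, and T - lambda is small on subspaces of finite codimension, which
   makes it compact.

   Conversely, let K be compact.  The images under K of many orthonormal vectors
   cannot all be large: many of them would be close to one vector, and their sum
   would be too large for a bounded operator.  So K is small on the orthogonal
   complement of finitely many orthonormal vectors e_i, whence K is uniformly
   close to x |-> sum_i <x, e_i> K e_i on balls.  Replacing K by this finite rank
   operator turns |lambda x + K x - y| into the square root of a polynomial in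
   inner products of x, y and parameters. *)

Import Order.TTheory GRing.Theory Num.Theory.
Import numFieldNormedType.Exports.

Set Implicit Arguments.
Unset Strict Implicit.
Unset Printing Implicit Defensive.

Local Open Scope classical_set_scope.
Local Open Scope ring_scope.

(** * Inner products, orthonormal lists and projections *)

Section HilbertGeometry.
Context {R : realType} {H : hilbertSpace R}.
Implicit Types (x y z e w a : H) (E L : seq H) (c : R[i]).

Local Notation "''[' u , v ]" := (inner H u v).

Lemma ipDl x y z : '[x + y, z] = '[x, z] + '[y, z].
Proof. by rewrite linearDl. Qed.

Lemma ipDr x y z : '[z, x + y] = '[z, x] + '[z, y].
Proof. by rewrite linearDr. Qed.

Lemma ipNl x y : '[- x, y] = - '[x, y].
Proof. by rewrite linearNl. Qed.

Lemma ipNr x y : '[x, - y] = - '[x, y].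
Proof. by rewrite linearNr. Qed.

Lemma ipBl x y z : '[x - y, z] = '[x, z] - '[y, z].
Proof. by rewrite ipDl ipNl. Qed.

Lemma ipBr x y z : '[z, x - y] = '[z, x] - '[z, y].
Proof. by rewrite ipDr ipNr. Qed.

Lemma ip0l x : '[0, x] = 0.
Proof. by rewrite linear0l. Qed.

Lemma ip0r x : '[x, 0] = 0.
Proof. by rewrite linear0r. Qed.

Lemma ipZl c x y : '[c *: x, y] = c * '[x, y].
Proof. by rewrite linearZl_LR. Qed.

Lemma ipZr c x y : '[x, c *: y] = c^* * '[x, y].
Proof. by rewrite linearZr_LR. Qed.

Lemma ip_conj x y : '[x, y]^* = '[y, x].
Proof. by rewrite [RHS]hermC mul1r. Qed.

Lemma ip_suml (I : Type) (r : seq I) (f : I -> H) y :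
  '[\sum_(i <- r) f i, y] = \sum_(i <- r) '[f i, y].
Proof. by elim/big_rec2: _ => [|i u v _ <-]; rewrite ?ip0l ?ipDl. Qed.

Lemma ip_sumr (I : Type) (r : seq I) (f : I -> H) y :
  '[y, \sum_(i <- r) f i] = \sum_(i <- r) '[y, f i].
Proof. by elim/big_rec2: _ => [|i u v _ <-]; rewrite ?ip0r ?ipDr. Qed.

Lemma ip_rnorm x : '[x, x] = ((rnorm x) ^+ 2)%:C%C.
Proof. by rewrite -inner_norm -rnormE rmorphXn. Qed.

Lemma rnorm_sqr x : rnorm x ^+ 2 = complex.Re '[x, x].
Proof. by rewrite ip_rnorm. Qed.

Lemma rnorm_sqrt x : rnorm x = Num.sqrt (complex.Re '[x, x]).
Proof. by rewrite -rnorm_sqr sqrtr_sqr ger0_norm ?rnorm_ge0. Qed.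

Lemma ip_unit x : rnorm x = 1 -> '[x, x] = 1.
Proof. by move=> x1; rewrite ip_rnorm x1 expr1n. Qed.

Lemma rnorm_unit x : '[x, x] = 1 -> rnorm x = 1.
Proof. by move=> x1; rewrite rnorm_sqrt x1 sqrtr1. Qed.

Lemma rnorm0 : rnorm (0 : H) = 0.
Proof. by rewrite /rnorm normr0. Qed.

Lemma rnorm_eq0 x : (rnorm x == 0) = (x == 0).
Proof. by rewrite -(inj_eq (@complexI _)) rnormE normr_eq0. Qed.

Lemma rnormB x y : rnorm (x - y) <= rnorm x + rnorm y.
Proof. by rewrite -[rnorm y]rnormN rnormD. Qed.

Lemma rnorm_distC x y : rnorm (x - y) = rnorm (y - x).
Proof. by rewrite -rnormN opprB. Qed.

Lemma rnorm_dist_triangle x y z : rnorm (x - z) <= rnorm (x - y) + rnorm (y - z).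
Proof. by rewrite -[x - z](subrKA y) rnormD. Qed.

Lemma rnorm_sum (I : Type) (r : seq I) (f : I -> H) :
  rnorm (\sum_(i <- r) f i) <= \sum_(i <- r) rnorm (f i).
Proof.
elim/big_rec2: _ => [|i u v _ le_uv]; first by rewrite rnorm0.
exact: le_trans (rnormD _ _) (lerD _ _).
Qed.

(** The modulus read in [R], since the norm on [R[i]] is itself complex-valued. *)
Definition cabs c : R := complex.Re `|c|.

Lemma cabsE c : (cabs c)%:C%C = `|c|.
Proof. by rewrite /cabs RRe_real // normr_real. Qed.

Lemma rnormZ c x : rnorm (c *: x) = cabs c * rnorm x.
Proof. by apply: complexI; rewrite rmorphM /= cabsE !rnormE normrZ. Qed.

Lemma cabsD c c' : cabs (c + c') <= cabs c + cabs c'.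
Proof. by rewrite -lecR rmorphD /= !cabsE ler_normD. Qed.

Lemma cabs_distC c c' : cabs (c - c') = cabs (c' - c).
Proof. by rewrite /cabs distrC. Qed.

Lemma normr_Re_le c : `|complex.Re c| <= cabs c.
Proof.
by rewrite /cabs normc_def /= -sqrtr_sqr ler_wsqrtr // lerDl sqr_ge0.
Qed.

Lemma normr_Im_le c : `|complex.Im c| <= cabs c.
Proof.
by rewrite /cabs normc_def /= -sqrtr_sqr ler_wsqrtr // lerDr sqr_ge0.
Qed.

Lemma cabs_le c : cabs c <= `|complex.Re c| + `|complex.Im c|.
Proof.
rewrite /cabs normc_def /= -[leRHS]ger0_norm ?addr_ge0 // -sqrtr_sqr.
rewrite ler_wsqrtr // sqrrD !real_normK ?num_real // -addrA lerD2l lerDr.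
by rewrite mulrn_wge0 // mulr_ge0.
Qed.

Lemma pythagoras x y : '[x, y] = 0 -> rnorm (x + y) ^+ 2 = rnorm x ^+ 2 + rnorm y ^+ 2.
Proof.
move=> xy0; have yx0 : '[y, x] = 0 by rewrite -ip_conj xy0 conjC0.
apply: complexI; rewrite rmorphD /= -!ip_rnorm ipDl !ipDr xy0 yx0.
by rewrite addr0 add0r.
Qed.

Definition orthogonal_to E x := forall e, e \in E -> '[x, e] = 0.

(** For orthonormal [E] this is the orthogonal projection onto the span of [E]. *)
Definition proj E x := \sum_(e <- E) '[x, e] *: e.

Lemma ip_sum_orthonormal E (f : H -> R[i]) e : orthonormal (inner H) E -> e \in E ->
  '[\sum_(a <- E) f a *: a, e] = f e.
Proof.
move=> /orthonormalP[uE oE] eE; rewrite ip_suml (bigD1_seq e) //= big_seq_cond.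
rewrite big1 => [|a /andP[aE ae]]; first by rewrite addr0 ipZl oE // eqxx mulr1.
by rewrite ipZl oE // (negbTE ae) mulr0.
Qed.

Lemma proj_orthogonal E x : orthonormal (inner H) E -> orthogonal_to E (x - proj E x).
Proof. by move=> oE e eE; rewrite ipBl ip_sum_orthonormal // subrr. Qed.

Lemma orthogonal_to_proj E x y : orthogonal_to E x -> '[x, proj E y] = 0.
Proof.
move=> xE; rewrite ip_sumr big_seq big1 // => e eE.
by rewrite ipZr xE // mulr0.
Qed.

Lemma rnorm_proj_decomp E x : orthonormal (inner H) E ->
  rnorm x ^+ 2 = rnorm (x - proj E x) ^+ 2 + rnorm (proj E x) ^+ 2.
Proof.
move=> oE; rewrite -pythagoras ?subrK //.
exact/orthogonal_to_proj/proj_orthogonal.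
Qed.

Lemma rnorm_sub_proj_le E x : orthonormal (inner H) E -> rnorm (x - proj E x) <= rnorm x.
Proof.
move=> oE; rewrite -(@ler_pXn2r _ 2) ?nnegrE ?rnorm_ge0 //.
by rewrite [leRHS](rnorm_proj_decomp _ oE) lerDl sqr_ge0.
Qed.

Lemma rnorm_proj_le E x : orthonormal (inner H) E -> rnorm (proj E x) <= rnorm x.
Proof.
move=> oE; rewrite -(@ler_pXn2r _ 2) ?nnegrE ?rnorm_ge0 //.
by rewrite [leRHS](rnorm_proj_decomp _ oE) lerDr sqr_ge0.
Qed.

Lemma orthonormal_rnorm E e : orthonormal (inner H) E -> e \in E -> rnorm e = 1.
Proof. by move=> /orthonormalP[_ oE] eE; apply: rnorm_unit; rewrite oE // eqxx. Qed.

Lemma orthonormal_cons E e :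
  orthonormal (inner H) E -> rnorm e = 1 -> orthogonal_to E e ->
  orthonormal (inner H) (e :: E).
Proof.
move=> oE e1 eE; have /orthonormalP[uE oE'] := oE; apply/orthonormalP; split.
  rewrite /= uE andbT; apply/negP => /eE /eqP.
  by rewrite ip_unit // oner_eq0.
have ne a : a \in E -> (e == a) = false.
  move=> aE; apply/negP => /eqP ea; have /eqP := eE _ aE.
  by rewrite -ea ip_unit // oner_eq0.
move=> a b; rewrite !inE => /predU1P[->|aE] /predU1P[->|bE].
- by rewrite eqxx ip_unit.
- by rewrite ne // eE.
- by rewrite eq_sym ne // -ip_conj eE // conjC0.
- exact: oE'.
Qed.

Lemma ip_unit_le e x : rnorm e = 1 -> cabs '[x, e] <= rnorm x.
Proof.
move=> e1; have oE : orthonormal (inner H) [:: e].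
  by apply: orthonormal_cons.
by have := rnorm_proj_le x oE; rewrite /proj big_seq1 rnormZ e1 mulr1.
Qed.

Lemma rnorm_sum_orthonormal E : orthonormal (inner H) E ->
  rnorm (\sum_(e <- E) e) ^+ 2 = (size E)%:R.
Proof.
move=> oE; apply: complexI; rewrite -ip_rnorm ip_sumr.
rewrite big_seq (eq_bigr (fun=> 1)) => [|e eE].
  by rewrite -big_seq big_const_seq count_predT iter_addr_0 rmorph_nat.
have := ip_sum_orthonormal (fun=> 1) oE eE.
by under eq_bigr do rewrite scale1r.
Qed.

(** At 0 the value is 0, so that [normalizeK] holds for every vector. *)
Definition normalize x := ((rnorm x)^-1)%:C%C *: x.

Lemma rnorm_normalize x : x != 0 -> rnorm (normalize x) = 1.
Proof.
move=> x0; rewrite rnormZr ger0_norm ?invr_ge0 ?rnorm_ge0 // mulVf //.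
by rewrite rnorm_eq0.
Qed.

Lemma normalizeK x : (rnorm x)%:C%C *: normalize x = x.
Proof.
have [->|x0] := eqVneq x 0; first by rewrite /normalize !scaler0.
by rewrite scalerA -rmorphM /= divff ?rnorm_eq0 // scale1r.
Qed.

Lemma orthogonal_toZ E c x : orthogonal_to E x -> orthogonal_to E (c *: x).
Proof. by move=> xE e eE; rewrite ipZl xE // mulr0. Qed.

(** Only orthogonal complements matter below, so instead of equality of spans it is recorded that
    the complement of [E] lies in that of [L]. *)
Lemma gram_schmidt L : exists2 E, orthonormal (inner H) E &
  forall x, orthogonal_to E x -> orthogonal_to L x.
Proof.
elim: L => [|a L [E oE EL]]; first by exists [::].
have [a0|a0] := eqVneq (a - proj E a) 0.
  exists E => // x xE b; rewrite inE => /predU1P[->|/EL]; last exact.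
  by rewrite (subr0_eq a0) orthogonal_to_proj.
exists (normalize (a - proj E a) :: E).
  apply: orthonormal_cons => //; first exact: rnorm_normalize.
  exact/orthogonal_toZ/proj_orthogonal.
move=> x xE; have xE' : orthogonal_to E x.
  by move=> e eE; apply: xE; rewrite inE eE orbT.
move=> b; rewrite inE => /predU1P[->|]; last exact: EL.
have -> : '[x, a] = '[x, a - proj E a].
  by rewrite ipBr orthogonal_to_proj // subr0.
by rewrite -(normalizeK (a - _)) ipZr xE ?mulr0 // mem_head.
Qed.

(** If every vector equalled its projection, the finite list [E] would span the whole space. *)
Lemma exists_unit_orthogonal L : infinite_dimensional H ->
  exists2 w, rnorm w = 1 & orthogonal_to L w.
Proof.
move=> Hinf; have [E oE EL] := gram_schmidt L.
suff [x x0] : exists x, x - proj E x != 0.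
  exists (normalize (x - proj E x)); first exact: rnorm_normalize.
  exact/EL/orthogonal_toZ/proj_orthogonal.
apply: contrapT => no; apply: Hinf; exists (size E), (fun i => nth 0 E i) => x.
exists (fun i => '[x, nth 0 E i]).
have /subr0_eq xE : x - proj E x = 0.
  by apply/eqP/negP => /negP x0; apply: no; exists x.
by rewrite {1}xE /proj (big_nth 0) big_mkord.
Qed.

End HilbertGeometry.

(** * Invariance of formulas under unitary involutions fixing their parameters *)

Section Invariance.
Context {R : realType} {H : hilbertSpace R} (A : set H).

Fixpoint term_params G n (t : term A G n) : seq H :=
  match t with
  | TVar _ _ => [::]
  | TPar _ a _ => [:: sval a]
  | TIncl _ _ _ t => term_params t
  | TAdd _ t1 t2 => term_params t1 ++ term_params t2
  | TSub _ t1 t2 => term_params t1 ++ term_params t2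
  | TScale _ _ _ _ t => term_params t
  | TMuli _ t => term_params t
  end.

Fixpoint formula_params G (phi : formula A G) : seq H :=
  match phi with
  | FDist _ t1 t2 => term_params t1 ++ term_params t2
  | FRe _ t1 t2 => term_params t1 ++ term_params t2
  | FIm _ t1 t2 => term_params t1 ++ term_params t2
  | FNorm _ t => term_params t
  | FConn _ _ _ args => flatten [seq formula_params (args i) | i <- enum 'I_ _]
  | FSup _ psi => formula_params psi
  | FInf _ psi => formula_params psi
  end.

Variable U : {linear H -> H}.
Hypothesis UK : involutive U.
Hypothesis U_ip : forall x y, inner H (U x) (U y) = inner H x y.

Lemma isometry_rnorm x : rnorm (U x) = rnorm x.
Proof. by rewrite !rnorm_sqrt U_ip. Qed.

Fact ball_map_subproof (n : ballSort) (x : Bsort H n) : rnorm (U (sval x)) <= n%:R.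
Proof. by rewrite isometry_rnorm (svalP x). Qed.

Definition ball_map (n : ballSort) (x : Bsort H n) : Bsort H n :=
  exist _ (U (sval x)) (ball_map_subproof x).

Lemma ball_mapK (n : ballSort) : involutive (@ball_map n).
Proof. by move=> x; apply: val_inj; rewrite /= UK. Qed.

Fixpoint env_map G : @env R H G -> @env R H G :=
  match G with
  | [::] => id
  | n :: G' => fun v => (ball_map v.1, env_map v.2)
  end.

Lemma eval_var_map G n (i : var G n) (v : @env R H G) :
  eval_var i (env_map v) = ball_map (eval_var i v).
Proof. by elim: i v => [//|? ? ? j IH] v /=; rewrite IH. Qed.

Lemma eval_term_map G n (t : term A G n) (v : @env R H G) :
  {in term_params t, forall a, U a = a} ->
  sval (eval_term (env_map v) t) = U (sval (eval_term v t)).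
Proof.
elim: t => {n} [n i|n a Aa|m n mn t IH|n t1 IH1 t2 IH2|n t1 IH1 t2 IH2|
  n r k rk t IH|n t IH] /= Ut.
- by rewrite eval_var_map.
- by rewrite Ut // mem_head.
- exact: IH.
- by rewrite linearD IH1 ?IH2 // => a at_; apply: Ut; rewrite mem_cat at_ ?orbT.
- by rewrite linearB IH1 ?IH2 // => a at_; apply: Ut; rewrite mem_cat at_ ?orbT.
- by rewrite linearZ IH.
- by rewrite linearZ IH.
Qed.

Lemma eval_map G (phi : formula A G) (v : @env R H G) :
  {in formula_params phi, forall a, U a = a} ->
  Defs.eval phi (env_map v) = Defs.eval phi v.
Proof.
have Ucat (s1 s2 : seq H) : {in s1 ++ s2, forall a, U a = a} ->
    {in s1, forall a, U a = a} /\ {in s2, forall a, U a = a}.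
  by move=> Us; split=> a at_; apply: Us; rewrite mem_cat at_ ?orbT.
(* An involution permutes each ball, so a quantified variable can be reindexed along [ball_map]
   without changing the supremum or infimum. *)
have range_map (n : ballSort) (G' : seq ballSort) (psi : formula A (n :: G'))
    (v' : @env R H G') :
    (forall x : Bsort H n,
       Defs.eval psi (@env_map (n :: G') (x, v')) = Defs.eval psi (x, v')) ->
    range (fun x : Bsort H n => Defs.eval psi (x, env_map v')) =
    range (fun x : Bsort H n => Defs.eval psi (x, v')).
  move=> psi_map; apply/seteqP; split=> r /= [x _ <-].
    by exists (ball_map x) => //; rewrite -psi_map /= ball_mapK.
  by exists (ball_map x) => //; rewrite -psi_map.
elim: phi v => {G} [G n t1 t2|G n t1 t2|G n t1 t2|G n t|G k u uc args IH|
  G n psi IH|G n psi IH] v /= Up.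
- have [Up1 Up2] := Ucat _ _ Up.
  by rewrite !eval_term_map // -linearB isometry_rnorm.
- by have [Up1 Up2] := Ucat _ _ Up; rewrite !eval_term_map // U_ip.
- by have [Up1 Up2] := Ucat _ _ Up; rewrite !eval_term_map // U_ip.
- by rewrite eval_term_map // isometry_rnorm.
- congr u; apply/rowP => i; rewrite !mxE IH // => a ai; apply: Up.
  apply/flattenP; exists (formula_params (args i)) => //.
  by apply: map_f; rewrite mem_enum.
- by rewrite range_map // => x; apply: IH.
- by rewrite range_map // => x; apply: IH.
Qed.

End Invariance.

(** * Reflections along a unit vector *)

Section Reflection.
Context {R : realType} {H : hilbertSpace R}.
Implicit Types (x y w : H).

Local Notation "''[' u , v ]" := (inner H u v).

Definition reflection w x : H := x - (2 * '[x, w]) *: w.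

Fact reflection_is_linear w : linear (reflection w).
Proof.
move=> c x y; rewrite /reflection ipDl ipZl mulrDr scalerDl opprD addrACA.
by rewrite scalerBr scalerA mulrCA.
Qed.

HB.instance Definition _ w :=
  GRing.isLinear.Build R[i] H H _ (reflection w) (reflection_is_linear w).

Lemma reflection_ip w x y : rnorm w = 1 -> '[reflection w x, reflection w y] = '[x, y].
Proof.
move=> w1; have c2 : (2 : R[i])^* = 2 by rewrite rmorph_nat.
rewrite /reflection ipBl !ipBr !ipZl !ipZr ip_unit // rmorphM /= c2 ip_conj.
ring.
Qed.

Lemma reflectionK w : rnorm w = 1 -> involutive (reflection w).
Proof.
move=> w1 x; rewrite /reflection ipBl ipZl ip_unit // -addrA -opprD -scalerDl.
rewrite [X in X *: w](_ : _ = 0) ?scale0r ?subr0 //; ring.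
Qed.

Lemma reflection_orthogonal w x : '[x, w] = 0 -> reflection w x = x.
Proof. by move=> xw; rewrite /reflection xw mulr0 scale0r subr0. Qed.

End Reflection.

(** * Approximate eigenvectors of definable operators *)

Section NearlyScalar.
Context {R : realType} {H : hilbertSpace R}.
Implicit Types (T : {linear H -> H}) (x y w : H).

Local Notation "''[' u , v ]" := (inner H u v).

Lemma definable_radius (A : set H) (f : H -> H) (n : ballSort) : definable_over A f ->
  exists m : ballSort, f @` Bset H n `<=` Bset H m /\
    definable_predicate A
      (fun (x : Bsort H n) (y : Bsort H m) => rnorm (f (sval x) - sval y)).
Proof.
move=> [fb fd]; have ex_m : exists m, `[< f @` Bset H n `<=` Bset H m >].
  by have [m fm] := fb n; exists m; apply/asboolP.
case: (ex_minnP ex_m) => m0 /asboolP fm0 m0min.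
(* The least radius may be 0, while sorts are positive; hence the successor. *)
exists (@BallSort m0.+1 isT); split.
  by move=> y /fm0 /le_trans; apply; rewrite ler_nat.
apply: (fd _ _ m0) => //; split=> // m' fm'; apply: m0min; exact/asboolP.
Qed.

(** Let U be the reflection along w. A formula e-close to |T x - y| has the same value d at (w, T w)
    and at (U w, U (T w)). There |T x - y| equals 0 and 2 |T w - <T w, w> w| respectively, so the
    latter is at most 2 e. *)
Lemma definable_nearly_eigen (A : set H) T (e : R) : definable_over A T -> 0 < e ->
  exists L : seq H, forall w, rnorm w = 1 -> orthogonal_to L w ->
    rnorm (T w - '[T w, w] *: w) <= e.
Proof.
move=> Tdef e0; have [m [Tm [phi phiP]]] := definable_radius (@BallSort 1 isT) Tdef.
have [N /(_ N (leqnn _)) NP] := phiP e e0; exists (formula_params (phi N)) => w w1 wL.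
have wB : rnorm w <= 1%:R by rewrite w1.
have TwB : rnorm (T w) <= m%:R by apply: Tm; exists w.
pose x : Bsort H (@BallSort 1 isT) := exist _ w wB.
pose y : Bsort H m := exist _ (T w) TwB.
pose U : {linear H -> H} := reflection w.
have UK : involutive U by apply: reflectionK.
have Uip a b : '[U a, U b] = '[a, b] by apply: reflection_ip.
have Ufix : {in formula_params (phi N), forall a, U a = a}.
  by move=> a aN; apply: reflection_orthogonal; rewrite -ip_conj wL // conjC0.
have := NP (ball_map Uip x) (ball_map Uip y).
have /= -> := @eval_map _ _ A U UK Uip _ (phi N) (x, (y, tt)) Ufix.
have := NP x y; rewrite /= subrr rnorm0 subr0.
set d := Defs.eval _ _.
have -> : T (reflection w w) - reflection w (T w) = - 2 *: (T w - '[T w, w] *: w).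
  rewrite /reflection ip_unit // mulr1 linearB linearZ /= scalerBr scalerA.
  by rewrite mulNr !scaleNr opprK opprB addrC addrA subrK addrC.
rewrite rnormZ (_ : cabs (- 2) = 2) => [|]; last first.
  by rewrite /cabs normrN normr_nat.
move=> d1 d2; have := ler_normD d (- (d - 2 * rnorm (T w - '[T w, w] *: w))).
rewrite normrN opprB addrCA subrr addr0 normrM ger0_norm // ger0_norm ?rnorm_ge0 //.
set q := rnorm _ in d2 *; lra.
Qed.

End NearlyScalar.

(** * Total boundedness and a criterion for compactness of operators *)

Section TotallyBounded.
Context {R : realType} {H : hilbertSpace R}.
Implicit Types (S : set H) (x y v : H) (L E : seq H).

Definition totally_bounded S := forall e : R, 0 < e ->
  exists L, forall x, S x -> exists2 y, y \in L & rnorm (x - y) <= e.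

Lemma rnorm_ballE x y (r : R) : ball x r%:C%C y = (rnorm (x - y) < r).
Proof. by rewrite -ball_normE /= -rnormE ltcR. Qed.

Lemma complex_gt0 (c : R[i]) : 0 < c -> exists2 r : R, 0 < r & c = r%:C%C.
Proof. 
move=> c0; have cE : c = (complex.Re c)%:C%C by rewrite RRe_real // gtr0_real.
by exists (complex.Re c); rewrite // -ltcR -cE.
Qed.

Lemma ultra_seq_cover (F : set_system H) (L : seq H) (B : H -> set H) :
  UltraFilter F -> F [set x | exists2 y, y \in L & B y x] -> exists y, F (B y).
Proof.
move=> FU; elim: L => [|y L IH] FL.
  suff : F set0 by move/filter_not_empty.
  by apply: filterS FL => x [].
have [|FnB] := in_ultra_setVsetC (B y) FU; first by exists y.
apply: IH; apply: filterS (filterI FL FnB) => x [[z]].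
by rewrite inE => /predU1P[->//|zL] Bzx _; exists z.
Qed.

(** By finite nets, an ultrafilter containing the closure of [S] contains balls of every radius, so
    it is Cauchy and converges by completeness. *)
Lemma totally_bounded_precompact S : totally_bounded S -> precompact S.
Proof.
move=> tbS; rewrite precompactE compact_ultra => F FU FS /=.
have Fcvg : cvg F.
  apply: cauchy_cvg; apply: cauchy_exP => eps /complex_gt0 [r r0 ->].
  (* One third of r leads from the closure into [S], another from [S] to the net; the sum stays
     strictly below r. *)
  have [L LP] := tbS (r / 3) ltac:(lra).
  apply: (@ultra_seq_cover F L (fun y => ball y r%:C%C)).
  apply: filterS FS => x clSx; have r30 : 0 < r / 3 by lra.
  have [z [Sz]] := clSx _ (nbhsx_ballx x (r / 3)%:C%C ltac:(by rewrite ltcR)).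
  rewrite rnorm_ballE => xz; have [y yL zy] := LP _ Sz; exists y => //.
  rewrite rnorm_ballE rnorm_distC.
  have := rnorm_dist_triangle x z y; lra.
exists (lim F); split=> //; apply: closed_closure.
move=> B FB; exact: (@filter_ex _ F _ _ (filterI FS (Fcvg _ FB))).
Qed.

Lemma precompact_totally_bounded S : precompact S -> totally_bounded S.
Proof.
rewrite precompactE compact_cover => Sc e e0.
have e0c : 0 < e%:C%C :> R[i] by rewrite ltcR.
have [|x _|D _ DP] := Sc H setT (fun y => ball y e%:C%C).
- by move=> y _; exact: ball_open.
- by exists x => //; exact: ballxx.
exists (finmap.enum_fset D) => x Sx; have [|y Dy] := DP x; first exact: subset_closure.
by rewrite rnorm_ballE rnorm_distC => /ltW xy; exists y.
Qed.

Lemma totally_bounded_approx S :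
  (forall e : R, 0 < e -> exists2 S', totally_bounded S' &
    forall x, S x -> exists2 y, S' y & rnorm (x - y) <= e) ->
  totally_bounded S.
Proof.
move=> ap e e0; have e20 : 0 < e / 2 by lra.
have [S' tbS' SS'] := ap _ e20; have [L LP] := tbS' _ e20.
exists L => x /SS'[y /LP[z zL yz] xy]; exists z => //.
have := rnorm_dist_triangle x y z; lra.
Qed.

Lemma unit_interval_grid (N : nat) (a : R) : (0 < N)%N -> `|a| <= 1 ->
  exists2 j, j \in iota 0 (2 * N).+1 & `|a - (j%:R / N%:R - 1)| <= N%:R^-1.
Proof.
(* The grid of step 1/N on [-1, 1] has 2N + 1 points; the index chosen is the integer part of (a +
   1) N. *)
rewrite ler_norml => N0 /andP[a1 a2]; pose t := (a + 1) * N%:R.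
have N0' : 0 < N%:R :> R by rewrite ltr0n.
have t0 : 0 <= t by rewrite mulr_ge0 //; lra.
have := truncn_itv t0; set j := Num.truncn t => /andP[jt tj].
exists j.
  rewrite mem_iota add0n /= ltnS -(ler_nat R) (le_trans jt) // natrM.
  by rewrite ler_pM2r //; lra.
have -> : a - (j%:R / N%:R - 1) = (t - j%:R) / N%:R.
  by rewrite /t; field; rewrite gt_eqF.
rewrite normrM [X in _ * X]gtr0_norm ?invr_gt0 // ler_piMl ?invr_ge0 ?ltW //.
rewrite ger0_norm ?subr_ge0 //; move: tj; rewrite -natr1; lra.
Qed.

Lemma totally_bounded_line v :
  totally_bounded [set c *: v | c in [set c : R[i] | cabs c <= 1]].
Proof.
(* The real and imaginary parts of the scalar are each approximated within 1/N, for a total error of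
   at most 2 |v| / N. *)
move=> e e0; pose N := (Num.truncn (2 * rnorm v / e)).+1.
have N0' : 0 < N%:R :> R by rewrite ltr0n.
have vN : 2 * rnorm v / N%:R <= e.
  by rewrite ler_pdivrMr // [leRHS]mulrC -ler_pdivrMr //; apply/ltW/truncnS_gt.
pose g (j : nat) : R := j%:R / N%:R - 1.
exists [seq (Complex (g j) (g k)) *: v | j <- iota 0 (2 * N).+1, k <- iota 0 (2 * N).+1].
move=> _ [c /= c1 <-].
have [j jN aj] := @unit_interval_grid N (complex.Re c) isT (le_trans (normr_Re_le c) c1).
have [k kN bk] := @unit_interval_grid N (complex.Im c) isT (le_trans (normr_Im_le c) c1).
exists (Complex (g j) (g k) *: v).
  exact: (allpairs_f (fun j k => Complex (g j) (g k) *: v) jN kN).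
rewrite -scalerBl rnormZ; apply: le_trans vN; rewrite mulrAC ler_wpM2r ?rnorm_ge0 //.
apply: le_trans (cabs_le _) _; case: c c1 aj bk => a b _ /= aj bk.
by rewrite mulr_natl mulr2n lerD.
Qed.

(** Such a set contains the image of the unit ball under the finite rank map x |-> sum_e <x, e> v e
    when [E] is orthonormal. *)
Lemma totally_bounded_sum (v : H -> H) E :
  totally_bounded [set \sum_(e <- E) f e *: v e |
    f in [set f | forall e, e \in E -> cabs (f e) <= 1]].
Proof.
elim: E => [|e E IH] r r0.
  by exists [:: 0] => _ [f _ <-]; exists 0; rewrite ?mem_head // big_nil subrr rnorm0 ltW.
have r20 : 0 < r / 2 by lra.
have [L1 L1P] := totally_bounded_line (v e) r20; have [L2 L2P] := IH _ r20.
exists [seq x + y | x <- L1, y <- L2] => _ [f /= f1 <-].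
have [|x xL1 fx] := L1P (f e *: v e).
  by exists (f e) => //; apply: f1; rewrite mem_head.
have [|y yL2 fy] := L2P (\sum_(e <- E) f e *: v e).
  by exists f => // a aE; apply: f1; rewrite inE aE orbT.
exists (x + y); first by apply/allpairsPdep; exists x, y.
rewrite big_cons opprD addrACA.
have := rnormD (f e *: v e - x) (\sum_(e <- E) f e *: v e - y); lra.
Qed.

(** On the unit ball K is uniformly close to K composed with a projection of finite rank, whose
    image there is totally bounded. *)
Lemma compact_operator_of_small_tails (K : {linear H -> H}) :
  (forall e : R, 0 < e ->
    exists L, forall x, orthogonal_to L x -> rnorm (K x) <= e * rnorm x) ->
  compact_operator K.
Proof.
move=> Ksmall; apply/totally_bounded_precompact/totally_bounded_approx => e e0.
have [L LP] := Ksmall e e0; have [E oE EL] := gram_schmidt L.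
eexists; first exact: (totally_bounded_sum K E).
move=> _ [x /= x1 <-]; exists (K (proj E x)).
  exists (fun a => inner H x a).
    by move=> a aE; exact: le_trans (ip_unit_le _ (orthonormal_rnorm oE aE)) x1.
  by rewrite /proj linear_sum /=; apply: eq_bigr => a _; rewrite linearZ.
rewrite -linearB; apply: le_trans (LP _ (EL _ (proj_orthogonal x oE))) _.
rewrite ler_piMr ?(ltW e0) //; exact: le_trans (rnorm_sub_proj_le _ oE) x1.
Qed.

End TotallyBounded.

(** * Definable operators are scalar plus compact *)

Section ScalarPlusCompact.
Context {R : realType} {H : hilbertSpace R}.
Hypothesis Hinf : infinite_dimensional H.
Implicit Types (T : {linear H -> H}) (x y w : H) (L : seq H) (c : R[i]).

Local Notation "''[' u , v ]" := (inner H u v).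

Lemma orthogonal_toD L x y :
  orthogonal_to L x -> orthogonal_to L y -> orthogonal_to L (x + y).
Proof. by move=> xL yL a aL; rewrite ipDl xL ?yL ?addr0. Qed.

(** The estimate for unit vectors extends by homogeneity; the scalar still depends on x. *)
Lemma definable_eigen_bound (A : set H) T (e : R) : definable_over A T -> 0 < e ->
  exists L, forall x, orthogonal_to L x -> exists c, rnorm (T x - c *: x) <= e * rnorm x.
Proof.
move=> Tdef e0; have [L LP] := definable_nearly_eigen Tdef e0; exists L => x xL.
have [->|x0] := eqVneq x 0.
  by exists 0; rewrite linear0 scaler0 subrr rnorm0 mulr0.
set w := normalize x; have w1 : rnorm w = 1 by exact: rnorm_normalize.
exists '[T w, w]; rewrite -(normalizeK x) -/w linearZ /= scalerA mulrC -scalerA.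
rewrite -scalerBr 2!rnormZr w1 mulr1 mulrC ler_wpM2r //.
by apply: LP => //; apply: orthogonal_toZ.
Qed.

(* T (w + w') is close both to c w + c' w' and to c'' (w + w'). *)
Lemma eigenvalues_close T (w w' : H) c c' c'' (e : R) :
  rnorm w = 1 -> rnorm w' = 1 -> '[w, w'] = 0 ->
  rnorm (T w - c *: w) <= e -> rnorm (T w' - c' *: w') <= e ->
  rnorm (T (w + w') - c'' *: (w + w')) <= 2 * e -> cabs (c - c') <= 8 * e.
Proof.
move=> w1 w1' ww' h h' h''; set s := w + w' in h''.
have ww'C : '[w', w] = 0 by rewrite -ip_conj ww' conjC0.
pose d := (c - c'') *: w + (c' - c'') *: w'.
have dn : rnorm d <= 4 * e.
  have -> : d = (T s - c'' *: s) - (T w - c *: w) - (T w' - c' *: w').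
    rewrite /d /s linearD scalerDr !scalerBl.
    move: (T w) (T w') (c *: w) (c' *: w') (c'' *: w) (c'' *: w') => a1 a2 a3 a4 a5 a6.
    have cancel (p q r : H) : (p - q) - (p - r) = r - q.
      by rewrite opprB addrC addrA subrK.
    by rewrite (opprD a5) (addrACA a1) -[RHS]addrA (addrACA (a1 - a5)) !cancel.
  have := rnormB (T s - c'' *: s - (T w - c *: w)) (T w' - c' *: w').
  have := rnormB (T s - c'' *: s) (T w - c *: w); lra.
(* Pairing d with w isolates the coefficient of w, because w' is orthogonal to w. *)
have d1 : cabs (c - c'') <= 4 * e.
  apply: le_trans dn; have := ip_unit_le d w1.
  by rewrite /d ipDl !ipZl ip_unit // ww'C mulr0 mulr1 addr0.
have d2 : cabs (c' - c'') <= 4 * e.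
  apply: le_trans dn; have := ip_unit_le d w1'.
  by rewrite /d ipDl !ipZl [X in _ * X + _]ww' ip_unit // mulr0 mulr1 add0r.
have -> : c - c' = (c - c'') + (c'' - c') by rewrite addrA subrK.
have := cabsD (c - c'') (c'' - c'); rewrite (cabs_distC c''); lra.
Qed.

(** One scalar serves all x: the eigenvalue of a fixed unit vector w0, provided x is also orthogonal
    to w0, so that [eigenvalues_close] compares the two eigenvalues. *)
Lemma definable_nearly_scalar (A : set H) T (e : R) : definable_over A T -> 0 < e ->
  exists c L, forall x, orthogonal_to L x -> rnorm (T x - c *: x) <= e * rnorm x.
Proof.
(* Of the error e, one ninth is the eigenvector estimate for w and eight ninths the distance between
   the eigenvalues of w and w0. *)
move=> Tdef e0; have e90 : 0 < e / 9 by lra.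
have [L LP] := definable_eigen_bound Tdef e90.
have [w0 w01 w0L] := exists_unit_orthogonal L Hinf.
have [c0 c0P] := LP _ w0L; exists c0, (w0 :: L) => x xL.
have [->|x0] := eqVneq x 0.
  by rewrite linear0 scaler0 subrr rnorm0 mulr0.
set w := normalize x; have w1 : rnorm w = 1 by exact: rnorm_normalize.
rewrite -(normalizeK x) -/w linearZ /= scalerA mulrC -scalerA -scalerBr.
rewrite 2!rnormZr w1 mulr1 mulrC ler_wpM2r //.
have wL : orthogonal_to (w0 :: L) w by exact: orthogonal_toZ.
have wL' : orthogonal_to L w.
  by move=> a aL; apply: wL; rewrite inE aL orbT.
have ww0 : '[w, w0] = 0 by apply: wL; rewrite mem_head.
have [c cP] := LP _ wL'.
have [c'' c''P] := LP _ (orthogonal_toD wL' w0L).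
rewrite w1 mulr1 in cP; rewrite w01 mulr1 in c0P.
have s2 : rnorm (w + w0) <= 2 by have := rnormD w w0; lra.
have cc0 : cabs (c - c0) <= 8 * (e / 9).
  apply: eigenvalues_close w1 w01 ww0 cP c0P (le_trans c''P _).
  by rewrite mulrC ler_wpM2r // ltW.
have := rnormD (T w - c *: w) ((c - c0) *: w).
rewrite rnormZ w1 mulr1 scalerBl addrA subrK; lra.
Qed.

(** The intervals [u n - e n, u n + e n] meet pairwise, so the supremum of their left endpoints lies
    in all of them. This gives a limit with an explicit rate. *)
Lemma nested_approximation (u e : nat -> R) :
  (forall n m, `|u n - u m| <= e n + e m) -> exists l, forall n, `|u n - l| <= e n.
Proof.
move=> ue; pose S : set R := range (fun n => u n - e n).
have Sub m : ubound S (u m + e m).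
  by move=> _ [n _ <-]; have := ue n m; rewrite ler_norml; lra.
have S0 : S !=set0 by exists (u 0 - e 0), 0.
exists (sup S) => n; rewrite ler_norml; apply/andP; split.
  have := ge_sup S0 (Sub n); lra.
have : u n - e n <= sup S by apply: ub_le_sup; [exists (u 0 + e 0)|exists n].
lra.
Qed.

Lemma definable_scalar_plus_compact T : definable T ->
  exists (lambda : R[i]) (K : {linear H -> H}),
    compact_operator K /\ forall x, T x = lambda *: x + K x.
Proof.
move=> [A Tdef]; pose e (n : nat) : R := n.+1%:R^-1.
have e0 n : 0 < e n by rewrite invr_gt0 ltr0n.
have [c cP] := choice (fun n => definable_nearly_scalar Tdef (e0 n)).
(* Both scalars nearly describe T on a common unit vector, orthogonal to both exceptional lists. *)
have c_close n m : cabs (c n - c m) <= e n + e m.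
  have [L LP] := cP n; have [L' LP'] := cP m.
  have [w w1 wLL] := exists_unit_orthogonal (L ++ L') Hinf.
  have wL : orthogonal_to L w by move=> a aL; apply: wLL; rewrite mem_cat aL.
  have wL' : orthogonal_to L' w by move=> a aL; apply: wLL; rewrite mem_cat aL orbT.
  have := rnorm_dist_triangle (c n *: w) (T w) (c m *: w).
  rewrite -scalerBl rnormZ w1 (rnorm_distC (c n *: w)).
  have := LP _ wL; have := LP' _ wL'; rewrite w1; lra.
have [a aP] : exists a, forall n, `|complex.Re (c n) - a| <= e n.
  apply: nested_approximation => n m; rewrite -raddfB.
  exact: le_trans (normr_Re_le _) (c_close n m).
have [b bP] : exists b, forall n, `|complex.Im (c n) - b| <= e n.
  apply: nested_approximation => n m; rewrite -raddfB.
  exact: le_trans (normr_Im_le _) (c_close n m).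
pose lambda := Complex a b.
have lambdaP n : cabs (c n - lambda) <= 2 * e n.
  apply: le_trans (cabs_le _) _; rewrite !raddfB /=.
  have := aP n; have := bP n; lra.
pose K : {linear H -> H} := T \- (lambda \*: idfun).
exists lambda, K; split; last by move=> x; rewrite /K /= addrC subrK.
apply: compact_operator_of_small_tails => r r0.
(* |K x| is at most e n |x| from the approximate scalar c n, plus 2 e n |x| from its distance to
   lambda. *)
pose n := Num.truncn (3 / r).
have n3 : 3 * e n <= r.
  rewrite /e ler_pdivrMr ?ltr0n // [leRHS]mulrC -ler_pdivrMr //.
  exact/ltW/truncnS_gt.
have [L LP] := cP n; exists L => x /LP xL.
apply: le_trans (ler_wpM2r (rnorm_ge0 x) n3).
have := rnormD (T x - c n *: x) ((c n - lambda) *: x).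
rewrite rnormZ scalerBl addrA subrK.
have := ler_wpM2r (rnorm_ge0 x) (lambdaP n); rewrite /K /=; lra.
Qed.

End ScalarPlusCompact.

(** * Compact operators are small on subspaces of finite codimension *)

Section CompactTails.
Context {R : realType} {H : hilbertSpace R}.
Implicit Types (K : {linear H -> H}) (x y : H) (L E : seq H).

Lemma rnorm_mulrn x (n : nat) : rnorm (x *+ n) = n%:R * rnorm x.
Proof.
by rewrite -scaler_nat -(rmorph_nat (real_complex R)) rnormZr normr_nat.
Qed.

Lemma compact_operator_bounded K : compact_operator K ->
  exists2 C : R, 0 <= C & forall x, rnorm (K x) <= C * rnorm x.
Proof.
move=> /precompact_totally_bounded /(_ 1 ltr01)[L LP].
(* The image of a unit vector is within 1 of some y in the net, and the sum dominates every |y|. *)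
exists (1 + \sum_(y <- L) rnorm y).
  by rewrite addr_ge0 // sumr_ge0 // => y _; exact: rnorm_ge0.
move=> x; have [->|x0] := eqVneq x 0.
  by rewrite linear0 !rnorm0 mulr0.
set w := normalize x; have w1 : rnorm w = 1 by exact: rnorm_normalize.
rewrite -(normalizeK x) -/w linearZ /= 2!rnormZr w1 mulr1 mulrC ler_wpM2r //.
have [|y yL Kwy] := LP (K w); first by exists w; rewrite //= w1.
have yS : rnorm y <= \sum_(y <- L) rnorm y.
  rewrite (big_rem y) //= lerDl sumr_ge0 // => z _; exact: rnorm_ge0.
have := rnormD (K w - y) y; rewrite subrK; lra.
Qed.

(** Pigeonhole principle in counting form, used to bound a list by the sizes of the clusters
    covering it. *)
Lemma size_le_sum_count (S V : Type) (p : S -> pred V) (s : seq S) (t : seq V) :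
  all (fun b => has (fun z => p z b) s) t ->
  (size t <= \sum_(z <- s) count (p z) t)%N.
Proof.
elim: t => [//|b t IH] /= /andP[bs /IH tL]; rewrite big_split /= -add1n leq_add //.
move: bs; rewrite has_count -sum1_count big_mkcond => /leq_trans; apply.
by apply: leq_sum => z _; case: (p z b).
Qed.

(* With M := size E, the norm of K (\sum_(a <- E) a) is at least M (|y| - e / 4),
   but at most C sqrt M. *)
Lemma orthonormal_cluster_bound K (C e : R) E y : 0 < e ->
  (forall x, rnorm (K x) <= C * rnorm x) -> orthonormal (inner H) E ->
  (forall a, a \in E -> e < rnorm (K a)) ->
  (forall a, a \in E -> rnorm (K a - y) <= e / 4) ->
  (size E)%:R <= 4 * C ^+ 2 / e ^+ 2.
Proof.
move=> e0 KC oE Ke Ky; set M : R := (size E)%:R.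
have M0 : 0 <= M by rewrite ler0n.
have [M00|Mn0] := eqVneq M 0.
  by rewrite M00 divr_ge0 ?sqr_ge0 // mulr_ge0 // sqr_ge0.
have M_gt0 : 0 < M by rewrite lt0r Mn0 M0.
have y_ge : 3 * e / 4 <= rnorm y.
  have : has predT E by rewrite has_predT -(ltr_nat R).
  move=> /hasP[a aE _].
  have := rnormD (K a - y) y; rewrite subrK; have := Ke _ aE; have := Ky _ aE; lra.
have sumK : rnorm (K (\sum_(a <- E) a) - y *+ size E) <= M * (e / 4).
  have -> : K (\sum_(a <- E) a) - y *+ size E = \sum_(a <- E) (K a - y).
    rewrite linear_sum sumrB; congr (_ - _).
    by rewrite big_const_seq count_predT iter_addr_0.
  apply: le_trans (rnorm_sum _ _) _; rewrite big_seq.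
  apply: le_trans (ler_sum _ Ky) _.
  by rewrite -big_seq big_const_seq count_predT iter_addr_0 mulr_natl.
have lower : M * e / 2 <= rnorm (K (\sum_(a <- E) a)).
  have := rnormB (K (\sum_(a <- E) a)) (K (\sum_(a <- E) a) - y *+ size E).
  rewrite opprB addrCA subrr addr0 rnorm_mulrn -/M.
  have := ler_wpM2l M0 y_ge; lra.
have upper := le_trans lower (KC _).
have : (M * e / 2) ^+ 2 <= C ^+ 2 * M.
  rewrite -[X in C ^+ 2 * X](rnorm_sum_orthonormal oE) -exprMn ler_sqr ?nnegrE //.
    by rewrite !mulr_ge0 // ltW.
  by apply: le_trans upper; rewrite !mulr_ge0 // ltW.
(* Multiplying the goal by the positive number M turns it into four times the squared inequality. *)
rewrite ler_pdivlMr ?exprn_gt0 // => h.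
rewrite -(ler_pM2l M_gt0); move: h; rewrite !exprMn exprVn; lra.
Qed.

(** Otherwise every orthonormal list could be extended by a vector with image larger than e.
    Arbitrarily long lists would result, although a finite e/4-net splits each into boundedly many
    clusters of bounded size. *)
Lemma compact_operator_small_tail K (e : R) : compact_operator K -> 0 < e ->
  exists2 E, orthonormal (inner H) E &
    forall x, orthogonal_to E x -> rnorm (K x) <= e * rnorm x.
Proof.
move=> Kc e0; have [C C0 KC] := compact_operator_bounded Kc.
have e40 : 0 < e / 4 by lra.
have [L LP] := precompact_totally_bounded Kc e40.
apply: contrapT => noE.
have extend E : orthonormal (inner H) E ->
    exists w, [/\ rnorm w = 1, orthogonal_to E w & e < rnorm (K w)].
  move=> oE; apply: contrapT => now; apply: noE; exists E => // x xE.
  have [->|x0] := eqVneq x 0; first by rewrite linear0 !rnorm0 mulr0.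
  set w := normalize x; have w1 : rnorm w = 1 by exact: rnorm_normalize.
  rewrite -(normalizeK x) -/w linearZ /= 2!rnormZr w1 mulr1 mulrC ler_wpM2r //.
  rewrite leNgt; apply/negP => Kw; apply: now; exists w; split=> //.
  exact: orthogonal_toZ.
have large N : exists E, [/\ orthonormal (inner H) E, size E = N &
    forall a, a \in E -> e < rnorm (K a)].
  elim: N => [|N [E [oE sE KE]]]; first by exists [::].
  have [w [w1 wE Kw]] := extend _ oE; exists (w :: E); split.
  - exact: orthonormal_cons.
  - by rewrite /= sE.
  - by move=> a; rewrite inE => /predU1P[->|/KE].
(* B exceeds the bound on one cluster, so a list of |L| B + 1 vectors is too long. *)
pose B := (Num.truncn (4 * C ^+ 2 / e ^+ 2)).+1.
have [E [oE sE KE]] := large (size L * B).+1.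
pose p y a := rnorm (K a - y) <= e / 4.
have : (size E <= \sum_(y <- L) count (p y) E)%N.
  apply: size_le_sum_count; apply/allP => a aE; apply/hasP.
  have [|y yL ay] := LP (K a); last by exists y.
  by exists a => //=; rewrite (orthonormal_rnorm oE aE).
rewrite sE ltnNge => /negP; apply.
rewrite [leqRHS]mulnC -iter_addn_0 -(count_predT L) -big_const_seq.
apply: leq_sum => y _; rewrite -size_filter ltnW // -(ltr_nat R).
apply: le_lt_trans (truncnS_gt _).
apply: (@orthonormal_cluster_bound K C e _ y) => //.
- apply: (sub_orthonormal _ _ oE); first exact: mem_subseq (filter_subseq _ _).
  by apply: filter_uniq; case/orthonormalP: oE.
- by move=> a; rewrite mem_filter => /andP[_ /KE].
- by move=> a; rewrite mem_filter => /andP[].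
Qed.

End CompactTails.

(** * Functions given exactly by formulas *)

Section FormulaAlgebra.
Context {R : realType} {H : hilbertSpace R} (A : set H) (G : seq ballSort).
Implicit Types (f g : @env R H G -> R) (h k : @env R H G -> R[i]).

Definition represented f := exists phi : formula A G, forall v, Defs.eval phi v = f v.

Definition crepresented h :=
  represented (fun v => complex.Re (h v)) /\ represented (fun v => complex.Im (h v)).

Lemma represented_ext f g : represented f -> f =1 g -> represented g.
Proof. by move=> [phi phiP] fg; exists phi => v; rewrite phiP. Qed.

Lemma represented_conn (n : nat) (u : 'rV[R]_n -> R) (f : 'I_n -> @env R H G -> R) :
  continuous u -> (forall i, represented (f i)) ->
  represented (fun v => u (\row_i f i v)).
Proof.
move=> uc /choice[phi phiP]; exists (FConn uc phi) => v /=.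
by congr u; apply/rowP => i; rewrite !mxE phiP.
Qed.

(** A constant is a connective of arity 0. *)
Lemma represented_cst (r : R) : represented (fun=> r).
Proof.
apply: (@represented_conn 0 (fun=> r) (fun _ _ => 0)) => [|[]//].
exact: cst_continuous.
Qed.

Lemma represented_sqrt f : represented f -> represented (fun v => Num.sqrt (f v)).
Proof.
move=> fr; pose u (v : 'rV[R]_1) := Num.sqrt (v ord0 ord0).
have uc : continuous u.
  move=> x; apply: (@continuous_comp _ _ _ (fun v : 'rV[R]_1 => v ord0 ord0) Num.sqrt).
    exact: coord_continuous.
  exact: sqrt_continuous.
apply: represented_ext (represented_conn uc (fun=> fr)) _ => v.
by rewrite /u mxE.
Qed.

Lemma represented_op2 (op : R -> R -> R) f g :
  continuous (fun v : 'rV[R]_2 => op (v ord0 ord0) (v ord0 ord_max)) ->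
  represented f -> represented g -> represented (fun v => op (f v) (g v)).
Proof.
move=> opc fr gr.
have fgr (i : 'I_2) : represented (if i == ord0 then f else g) by case: ifP.
by apply: represented_ext (represented_conn opc fgr) _ => v; rewrite !mxE.
Qed.

Lemma representedD f g :
  represented f -> represented g -> represented (fun v => f v + g v).
Proof.
apply: (@represented_op2 +%R) => v.
by apply: continuousD; exact: coord_continuous.
Qed.

Lemma representedM f g :
  represented f -> represented g -> represented (fun v => f v * g v).
Proof.
apply: (@represented_op2 *%R) => v.
by apply: continuousM; exact: coord_continuous.
Qed.

Lemma representedN f : represented f -> represented (fun v => - f v).
Proof.
move=> fr; apply: represented_ext (representedM (represented_cst (- 1)) fr) _ => v.
by rewrite mulN1r.
Qed.

Lemma crepresented_cst (c : R[i]) : crepresented (fun=> c).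
Proof. by split; exact: represented_cst. Qed.

Lemma crepresentedD h k :
  crepresented h -> crepresented k -> crepresented (fun v => h v + k v).
Proof.
move=> [hr hi] [kr ki]; split.
  by apply: represented_ext (representedD hr kr) _ => v; rewrite raddfD.
by apply: represented_ext (representedD hi ki) _ => v; rewrite raddfD.
Qed.

Lemma crepresentedM h k :
  crepresented h -> crepresented k -> crepresented (fun v => h v * k v).
Proof.
move=> [hr hi] [kr ki]; split.
  apply: represented_ext
    (representedD (representedM hr kr) (representedN (representedM hi ki))) _ => v.
  by case: (h v) (k v) => ? ? [? ?].
apply: represented_ext (representedD (representedM hr ki) (representedM hi kr)) _ => v.
by case: (h v) (k v) => ? ? [? ?].
Qed.

Lemma crepresented_conj h : crepresented h -> crepresented (fun v => (h v)^*).
Proof.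
move=> [hr hi]; split.
  by apply: represented_ext hr _ => v; case: (h v).
by apply: represented_ext (representedN hi) _ => v; case: (h v).
Qed.

Lemma crepresented_sum (I : Type) (r : seq I) (h : I -> @env R H G -> R[i]) :
  (forall i, crepresented (h i)) -> crepresented (fun v => \sum_(i <- r) h i v).
Proof.
move=> hr; elim: r => [|i r IH].
  by under boolp.eq_fun do rewrite big_nil; exact: crepresented_cst.
by under boolp.eq_fun do rewrite big_cons; exact: crepresentedD.
Qed.

Lemma crepresented_ip (n : ballSort) (t t' : term A G n) :
  crepresented (fun v => inner H (sval (eval_term v t)) (sval (eval_term v t'))).
Proof. by split; [exists (FRe t t')|exists (FIm t t')]. Qed.

(** The combination need not be a term, as its coefficients vary with the variables. Its squared
    norm, however, expands into the sum of c_i conj(c_j) <t_i, t_j>, built from formulas by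
    continuous connectives. *)
Lemma represented_rnorm_combination (n : ballSort) (I : Type) (r : seq I)
    (c : I -> @env R H G -> R[i]) (t : I -> term A G n) :
  (forall i, crepresented (c i)) ->
  represented (fun v => rnorm (\sum_(i <- r) c i v *: sval (eval_term v (t i)))).
Proof.
move=> cr; under boolp.eq_fun do rewrite rnorm_sqrt ip_suml.
apply: represented_sqrt.
apply: (proj1 (@crepresented_sum _ _
  (fun i v => inner H (c i v *: sval (eval_term v (t i)))
    (\sum_(j <- r) c j v *: sval (eval_term v (t j)))) _)) => i.
under boolp.eq_fun do rewrite ip_sumr.
apply: crepresented_sum => j; under boolp.eq_fun do rewrite ipZl ipZr.
apply: crepresentedM => //; apply: crepresentedM; first exact: crepresented_conj.
exact: crepresented_ip.
Qed.

End FormulaAlgebra.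

(** * Scalar plus compact operators are definable *)

Section ScalarPlusCompactDefinable.
Context {R : realType} {H : hilbertSpace R}.
Implicit Types (T K : {linear H -> H}) (x y : H) (E : seq H).

Lemma rnorm_dist_dist x y : `|rnorm x - rnorm y| <= rnorm (x - y).
Proof.
have := rnormD (x - y) y; have := rnormD (y - x) x; rewrite !subrK rnorm_distC.
by rewrite ler_norml; lra.
Qed.

Lemma represented_finite_rank (n m : ballSort) (lambda : R[i]) E (f : H -> H) :
  represented [set: H] (fun v : @env R H [:: n; m] =>
    rnorm (lambda *: sval v.1 + \sum_(a <- E) inner H (sval v.1) a *: f a - sval v.2.1)).
Proof.
(* Inner product formulas compare terms of one sort, so x, y and all parameters a and f a are placed
   in a common ball of radius N. *)
pose N := (n + m + \sum_(a <- E) (Num.truncn (rnorm a) + Num.truncn (rnorm (f a))).+2)%N.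
have N0 : (0 < N)%N by rewrite /N -addnA addn_gt0 radius_gt0.
pose S := BallSort N0.
have nS : (n <= S)%N by rewrite /= /N -addnA leq_addr.
have mS : (m <= S)%N by rewrite /= /N addnAC leq_addl.
pose X : term [set: H] [:: n; m] S := TIncl nS (TVar _ (Var0 n [:: m])).
pose Y : term [set: H] [:: n; m] S := TIncl mS (TVar _ (VarS n (Var0 m [::]))).
(* The junk value 0 makes P total; it does not occur for the parameters used. *)
pose trunc (z : H) := if rnorm z <= S%:R then z else 0.
have truncB z : rnorm (trunc z) <= S%:R by rewrite /trunc; case: ifP; rewrite // rnorm0.
pose P z : term [set: H] [:: n; m] S :=
  @TPar _ _ [set: H] [:: n; m] S (exist _ (trunc z) (truncB z)) I.
have truncE a z : a \in E -> rnorm z <= rnorm a + rnorm (f a) -> trunc z = z.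
  move=> aE zaf; rewrite /trunc ifT //; apply: le_trans zaf _.
  have aN : ((Num.truncn (rnorm a)).+1 + (Num.truncn (rnorm (f a))).+1 <= N)%N.
    by rewrite /N (big_rem a) //= addSnnS !addnS addnA; lia.
  apply: le_trans (_ : _ <= ((Num.truncn (rnorm a)).+1 + (Num.truncn (rnorm (f a))).+1)%:R) _.
    by rewrite natrD lerD // ltW // truncnS_gt.
  by rewrite ler_nat.
pose I0 := option (option H).
pose c (i : I0) (v : @env R H [:: n; m]) : R[i] := match i with
  | None => lambda | Some None => - 1 | Some (Some a) => inner H (sval v.1) (trunc a) end.
pose t (i : I0) := match i with None => X | Some None => Y | Some (Some a) => P (f a) end.
have cr i : crepresented [set: H] (c i).
  case: i => [[a|]|] /=; [|exact: crepresented_cst|exact: crepresented_cst].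
  exact: (crepresented_ip X (P a)).
apply: represented_ext (represented_rnorm_combination
  (None :: Some None :: [seq Some (Some a) | a <- E]) t cr) _ => -[x [y []]] /=.
rewrite !big_cons big_map /= scaleN1r [X in _ = rnorm X]addrAC -addrA.
congr (rnorm (_ + (_ + _))); rewrite !big_seq; apply: eq_bigr => a aE.
by rewrite !(truncE a) // ?lerDl ?lerDr ?rnorm_ge0.
Qed.

Lemma scalar_plus_compact_definable T K (lambda : R[i]) : bounded_operator T ->
  compact_operator K -> (forall x, T x = lambda *: x + K x) -> definable T.
Proof.
move=> [M TM] Kc TE; exists [set: H]; split.
  move=> n; exists (Num.truncn (`|M| * n%:R)).+1 => _ [x xn <-]; rewrite /Bset /=.
  apply: le_trans (ltW (truncnS_gt _)); apply: le_trans (TM x) _.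
  apply: le_trans (ler_wpM2r (rnorm_ge0 x) (ler_norm M)) _.
  exact: ler_wpM2l.
move=> n m _ _ _.
have n0 : 0 < n%:R :> R by rewrite ltr0n radius_gt0.
have approx (j : nat) : exists phi : formula [set: H] [:: n; m],
    forall (x : Bsort H n) (y : Bsort H m),
    `|Defs.eval phi (x, (y, tt)) - rnorm (T (sval x) - sval y)| <= j.+1%:R^-1.
  (* The error on the tail is proportional to |x|, at most n; dividing by n makes it at most 1/(j +
     1) on the ball. *)
  have e0 : 0 < j.+1%:R^-1 / n%:R :> R by rewrite divr_gt0 // invr_gt0 ltr0n.
  have [E oE EP] := compact_operator_small_tail Kc e0.
  have [phi phiP] := represented_finite_rank n m lambda E K.
  exists phi => x y; rewrite phiP /= TE; apply: le_trans (rnorm_dist_dist _ _) _.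
  have -> : \sum_(a <- E) inner H (sval x) a *: K a = K (proj E (sval x)).
    by rewrite linear_sum; apply: eq_bigr => a _; rewrite linearZ.
  (* The terms lambda x and y cancel, leaving K applied to x minus its projection, which is
     orthogonal to [E]. *)
  rewrite !(addrAC _ _ (- sval y)) opprD addrACA subrr add0r rnorm_distC -linearB.
  apply: le_trans (EP _ (proj_orthogonal _ oE)) _.
  rewrite mulrAC ler_pdivrMr // ler_wpM2l ?invr_ge0 //.
  exact: le_trans (rnorm_sub_proj_le _ oE) (svalP x).
have [phi phiP] := choice approx; exists phi => e e0.
exists (Num.truncn e^-1) => j jN x y; apply: le_trans (phiP j x y) _.
rewrite -[leRHS]invrK lef_pV2 ?posrE ?invr_gt0 ?ltr0n //.
apply: le_trans (ltW (truncnS_gt _)) _; by rewrite ler_nat ltnS.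
Qed.

End ScalarPlusCompactDefinable.

Theorem theorem4p1 (R : realType) (H : hilbertSpace R)
  (Hinf : infinite_dimensional H) (T : {linear H -> H})
  (Tbnd : bounded_operator T) :
  definable T <->
  exists (lambda : R[i]) (K : {linear H -> H}),
    compact_operator K /\ forall x : H, T x = lambda *: x + K x.
Proof.
split; first exact: definable_scalar_plus_compact.
by move=> [lambda [K [Kc TE]]]; exact: scalar_plus_compact_definable Kc TE.
Qed.
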